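(* Let $F=f+\psi$ satisfy Assumption A (see context), let $(x_k)_{k\ge 0}$ be generated by algorithm SCPG, let the well-alignment Assumption B hold with parameters $\alpha,\delta\in(0,1)$, suppose that the sublevel set $\mathcal{L}_F(x_0)=\{x:F(x)\le F(x_0)\}$ is bounded, and assume additionally that $F$ is convex. Let $X^*$ be the set of minimizers of $F$, let $x^*\in X^*$, and let $$R=\max_{y}\ \min_{x^*\in X^*}\{\|y-x^*\|:\ F(y)\le F(x_0)\}.$$ Let $C=\frac{\alpha^2\eta_{\min}}{2H_{F,\max}^2}$ and $\beta\in(0,1)$, and let $k_0$ denote the first well-aligned iteration. Then for any number of iterations $K$ satisfying $$K>\max\left\{\frac{1}{(1-\beta)(1-\delta)}-1,\ k_0\right\}$$ the sequence $(x_k)_{k\ge0}$ has with high probability the following sublinear rate in function values: $$\mathbb{P}\left[F(x_K)-F(x^* )\le\frac1C\left(\frac{R^2}{(1-\beta)(1-\delta)(K+1)-1}\right)\right]\ge1-e^{-\frac{\beta^2}{2}(1-\delta)(K+1)} .$$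
   Context: Norms of vectors are Euclidean; norms of matrices are spectral unless marked $\|\cdot\|_F$ (Frobenius). Problem: $F^*=\min_{x\in\mathbb{R}^n}F(x)$, $F=f+\psi$. Assumption A: $\mathcal{U}\subset\mathbb{R}^{n\times p}$ is a bounded family of matrices. (A.1) $f:\mathbb{R}^n\to\mathbb{R}$ is continuously differentiable (possibly nonconvex) and for each $U\in\mathcal{U}$ there is $L_U$ with $\|U^T(\nabla f(x+Uh)-\nabla f(x))\|\le L_U\|h\|$ for all $x\in\mathbb{R}^n$, $h\in\mathbb{R}^p$. (A.2) $\psi:\mathbb{R}^n\to\mathbb{R}$ is simple (its proximal operator along the subspaces generated by $U\in\mathcal{U}$ is easy to compute) and twice continuously differentiable (possibly nonseparable and nonconvex). (A.3) A minimizer of $F$ exists (so $F^*>-\infty$). $\psi$ is convex along the subspaces from $\mathcal{U}$ if for every $x\in\mathbb{R}^n$ and $U\in\mathcal{U}$ the function $d\mapsto\psi(x+Ud)$ is convex. Algorithm SCPG: given a starting point $x_0\in\mathbb{R}^n$, at each iteration $k\ge 0$ sample a random $U_k\sim\mathcal{U}$, choose $\eta_{U_k}>0$, set $H_{f,U_k}=\frac{L_{U_k}+\eta_{U_k}}{2}$ if $\psi$ is convex along the subspaces from $\mathcal{U}$, and $H_{f,U_k}=L_{U_k}+\eta_{U_k}$ otherwise; take $$d_k\in\arg\min_{d\in\mathbb{R}^p} f(x_k)+\langle U_k^T\nabla f(x_k),d\rangle+\frac{H_{f,U_k}}{2}\|d\|^2+\psi(x_k+U_kd)$$ and set $x_{k+1}=x_k+U_kd_k$.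 Well-alignment: $U_k$ is well-aligned (and $k$ is a well-aligned iteration) if $\|U_k^T\nabla F(x_k)\|\ge\alpha\|\nabla F(x_k)\|$, where $\alpha\in(0,1)$ is independent of the iteration $k$. Assumption B: at each iteration $k$ the matrix $U_k$ is well-aligned for the fixed $\alpha\in(0,1)$ with probability at least $1-\delta$, $\delta\in(0,1)$, independently of the filtration $\{U_0,\dots,U_{k-1}\}$. Constants: for $z_1,\dots,z_n\in\mathbb{R}^n$ let $\bar\nabla^2\Psi(z_1,\dots,z_n)$ be the $n\times n$ matrix whose $i$-th row is the $i$-th row of the Hessian $\nabla^2\psi(z_i)$, and let $$H_{F,U_k}=\max_{z_1,\dots,z_n\in\mathrm{conv}(\mathcal{L}_F(x_0))}\|U_k^T\bar\nabla^2\Psi(z_1,\dots,z_n)U_k+H_{f,U_k}I_p\|_F .$$ $H_{F,\max}$ is a finite constant with $H_{F,U_k}\le H_{F,\max}$ for all $k\ge0$, and $\eta_{\min}=\min_k\eta_{U_k}>0$. *)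

(* Defs.v *)
From HB Require Import structures.
From mathcomp Require Import all_boot all_order all_algebra.
From mathcomp Require Import all_classical all_reals all_analysis.

Set Implicit Arguments.
Unset Strict Implicit.
Unset Printing Implicit Defensive.

Import Order.TTheory GRing.Theory Num.Theory.
Import numFieldNormedType.Exports.

Local Open Scope classical_set_scope.
Local Open Scope ring_scope.

Section Euclidean.
Context {R : realType}.

(* The Frobenius norm; on column vectors it is the Euclidean norm.  The norm
   `|_| that the library puts on matrices is the entrywise maximum and is used
   only through the topology and the bounded sets, on which it agrees with the
   Euclidean, Frobenius and spectral norms. *)
Definition fnorm m n (A : 'M[R]_(m, n)) : R :=
  Num.sqrt (\sum_i \sum_j A i j ^+ 2).

Definition dotv n (u v : 'cV[R]_n) : R := \sum_i u i 0 * v i 0.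

Definition argmin (T : Type) (g : T -> R) : set T :=
  [set x | forall y, g x <= g y].

Definition sublevel (T : Type) (g : T -> R) (x0 : T) : set T :=
  [set x | g x <= g x0].

Definition conv_hull n (A : set 'cV[R]_n) : set 'cV[R]_n :=
  smallest (@convex_set R 'cV[R]_n) A.

End Euclidean.

Section Calculus.
Context {R : realType} {n : nat}.
Implicit Types (g : 'cV[R]_n -> R) (x : 'cV[R]_n).

Definition gradient g x : 'cV[R]_n :=
  \col_i 'D_(delta_mx i 0) (g : 'cV[R]_n -> R^o) x.

Definition C1 g : Prop :=
  (forall x, differentiable (g : 'cV[R]_n -> R^o) x) /\ continuous (gradient g).

Definition C2 g : Prop :=
  C1 g /\ forall i, C1 (fun x => gradient g x i 0).

Definition hessian g x : 'M[R]_n :=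
  \matrix_(i, j) gradient (fun y => gradient g y i 0) x j 0.

(* Row i is row i of the Hessian at the i-th point. *)
Definition row_hessian g (z : 'I_n -> 'cV[R]_n) : 'M[R]_n :=
  \matrix_(i, j) hessian g (z i) i j.

End Calculus.

Section Problem.
Context {R : realType} {n p : nat}.
Implicit Types (f psi : 'cV[R]_n -> R) (calU : set 'M[R]_(n, p))
  (L : 'M[R]_(n, p) -> R) (x : 'cV[R]_n) (U : 'M[R]_(n, p)).

Definition subspace_lipschitz f calU L : Prop :=
  forall U, calU U -> forall x (h : 'cV[R]_p),
    fnorm (U^T *m (gradient f (x + U *m h) - gradient f x)) <= L U * fnorm h.

(* That psi is "simple" has no mathematical content. *)
Record assumptionA f psi calU L : Prop := AssumptionA {
  family_bounded : bounded_set calU ;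
  smooth_f : C1 f ;
  lipschitz_f : subspace_lipschitz f calU L ;
  smooth_psi : C2 psi ;
  minimizer_exists : argmin (f \+ psi) !=set0
}.

Definition convex_along psi calU : Prop :=
  forall x U, calU U ->
    @convex_function R 'cV[R]_p setT (fun d => psi (x + U *m d)).

Definition Hf psi calU L U (eta : R) : R :=
  if `[< convex_along psi calU >] then (L U + eta) / 2 else L U + eta.

Definition model f psi x U (H : R) (d : 'cV[R]_p) : R :=
  f x + dotv (U^T *m gradient f x) d + H / 2 * fnorm d ^+ 2
    + psi (x + U *m d).

(* The supremum is that of a continuous function over a compact set whenever
   the sublevel set is bounded, hence a maximum. *)
Definition HF f psi (x0 : 'cV[R]_n) U (H : R) : \bar R :=
  ereal_sup [set (fnorm (U^T *m row_hessian psi z *m U + H%:M))%:E |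
    z in [set z | forall i, conv_hull (sublevel (f \+ psi) x0) (z i)]].

(* Both extrema are attained when the sublevel set is bounded and F continuous. *)
Definition level_radius (F : 'cV[R]_n -> R) (x0 : 'cV[R]_n) : R :=
  sup [set inf [set fnorm (y - xs) | xs in argmin F] | y in sublevel F x0].

Definition rateC (alpha eta_min HFmax : R) : R :=
  alpha ^+ 2 * eta_min / (2 * HFmax ^+ 2).

End Problem.

Section Algorithm.
Context {R : realType} {n p : nat} {d : measure_display} {Omega : measurableType d}.
Implicit Types (U : nat -> Omega -> 'M[R]_(n, p)).

(* sigma(U_0, ..., U_{k-1}); the Borel sigma-algebra of matrices is generated
   by the entries. *)
Definition past U (k : nat) : set (set Omega) :=
  <<s [set A | exists j i l, (j < k)%N /\
         preimage_set_system setT (fun w => U j w i l) measurable A] >>.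

(* [s] is the sequence of steps d_k.  The model may have several minimizers;
   [step_adapted] says that the one chosen is determined (measurably) by the
   matrices sampled so far, so that x_k is a function of U_0, ..., U_{k-1}. *)
Record scpg (f psi : 'cV[R]_n -> R) (calU : set 'M[R]_(n, p))
    (L : 'M[R]_(n, p) -> R) (x0 : 'cV[R]_n)
    U (eta : nat -> Omega -> R) (s : nat -> Omega -> 'cV[R]_p)
    (x : nat -> Omega -> 'cV[R]_n) : Prop := SCPG {
  sample_random : forall k i j, measurable_fun setT (fun w => U k w i j) ;
  sample_in : forall k w, calU (U k w) ;
  eta_gt0 : forall k w, 0 < eta k w ;
  step_adapted : forall k i (B : set R), measurable B ->
    past U k.+1 ((fun w => s k w i 0) @^-1` B) ;
  step_argmin : forall k w,
    argmin (model f psi (x k w) (U k w) (Hf psi calU L (U k w) (eta k w)))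
           (s k w) ;
  iter0 : forall w, x 0%N w = x0 ;
  iterS : forall k w, x k.+1 w = x k w + U k w *m s k w
}.

Definition eta_inf (eta : nat -> Omega -> R) : R :=
  inf [set eta k w | k in setT & w in setT].

Definition well_aligned (F : 'cV[R]_n -> R) (alpha : R) U
    (x : nat -> Omega -> 'cV[R]_n) (k : nat) : set Omega :=
  [set w | alpha * fnorm (gradient F (x k w))
           <= fnorm ((U k w)^T *m gradient F (x k w))].

(* P[W_k | U_0, ..., U_{k-1}] >= 1 - delta almost surely *)
Definition assumptionB (P : probability Omega R) U (W : nat -> set Omega)
    (delta : R) : Prop :=
  forall k A, past U k A -> ((1 - delta)%:E * P A <= P (A `&` W k))%E.

(* +oo on the runs where no iteration is well aligned *)
Definition first_time (W : nat -> set Omega) (w : Omega) : \bar R :=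
  ereal_inf [set (k%:R)%:E | k in [set k | W k w]].

End Algorithm.

(* Main.v *)
Require Import Defs.
From HB Require Import structures.
From mathcomp Require Import all_boot all_order all_algebra.
From mathcomp Require Import all_classical all_reals all_analysis.
From mathcomp Require Import measurable_realfun ring lra.

Set Implicit Arguments.
Unset Strict Implicit.
Unset Printing Implicit Defensive.

Import Order.TTheory GRing.Theory Num.Theory.
Import numFieldNormedType.Exports.

Local Open Scope classical_set_scope.
Local Open Scope ring_scope.

(* Every step decreases F by at least (eta_min / 2) |d_k|^2, while the optimality
   condition of d_k and the mean value theorem applied to each row of the
   gradient of psi give |U_k^T grad F(x_k)| <= H_{F,max} |d_k|.  Convexity gives
   F(x_k) - F* <= R |grad F(x_k)|, so with e_k = F(x_k) - F* a well-aligned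
   iteration satisfies C e_k^2 <= R^2 (e_k - e_{k+1}), and e_k decreases like
   R^2 / (C N_k), N_k being the number of well-aligned iterations before k.  A
   Chernoff bound for conditionally likely events shows that
   N_{K+1} >= (1 - beta)(1 - delta)(K + 1) with the required probability; this
   bound exceeds 1, hence N_K >= N_{K+1} - 1 > 0 and k_0 < K. *)

(** * Euclidean and Frobenius norms *)

Section EuclideanSpace.
Context {R : realType}.

(** With [A], [B], [c] the three sums, the sum of the squares of [B * a i - c * b i] equals
    [B * (A * B - c ^+ 2)]; its sign gives the claim when [B] is positive. *)
Lemma cauchy_schwarz (I : finType) (a b : I -> R) :
  (\sum_i a i * b i) ^+ 2 <= (\sum_i a i ^+ 2) * (\sum_i b i ^+ 2).
Proof.
set c := \sum_i a i * b i; set A := \sum_i a i ^+ 2; set B := \sum_i b i ^+ 2.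
have B0 : 0 <= B by apply: sumr_ge0 => i _; rewrite sqr_ge0.
have [Bz|Bnz] := eqVneq B 0.
  have -> : c = 0.
    apply: big1 => i _.
    have /eqP : b i ^+ 2 = 0.
      by apply: (psumr_eq0P _ Bz) => // j _; exact: sqr_ge0.
    by rewrite sqrf_eq0 => /eqP ->; rewrite mulr0.
  by rewrite Bz mulr0 expr0n.
have Bpos : 0 < B by rewrite lt_def Bnz.
have : 0 <= \sum_i (B * a i - c * b i) ^+ 2.
  by apply: sumr_ge0 => i _; rewrite sqr_ge0.
have -> : \sum_i (B * a i - c * b i) ^+ 2 = B * (A * B - c ^+ 2).
  transitivity (\sum_i (B ^+ 2 * a i ^+ 2 + (- (2 * B * c)) * (a i * b i)
                        + c ^+ 2 * b i ^+ 2)).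
    by apply: eq_bigr => i _; ring.
  rewrite !big_split /= -!mulr_sumr -/A -/B -/c; ring.
by rewrite pmulr_rge0// subr_ge0.
Qed.

Lemma fnorm_ge0 m n (A : 'M[R]_(m, n)) : 0 <= fnorm A.
Proof. exact: sqrtr_ge0. Qed.

Lemma fnorm_sqr m n (A : 'M[R]_(m, n)) : fnorm A ^+ 2 = \sum_i \sum_j A i j ^+ 2.
Proof.
rewrite sqr_sqrtr//; apply: sumr_ge0 => i _.
by apply: sumr_ge0 => j _; rewrite sqr_ge0.
Qed.

Lemma dotvv n (v : 'cV[R]_n) : dotv v v = fnorm v ^+ 2.
Proof. by rewrite fnorm_sqr; apply: eq_bigr => i _; rewrite big_ord1. Qed.

Lemma fnormN m n (A : 'M[R]_(m, n)) : fnorm (- A) = fnorm A.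
Proof.
congr Num.sqrt; apply: eq_bigr => i _; apply: eq_bigr => j _.
by rewrite mxE sqrrN.
Qed.

Lemma dotvE n (u v : 'cV[R]_n) : dotv u v = (u^T *m v) 0 0.
Proof. by rewrite mxE; apply: eq_bigr => i _; rewrite mxE. Qed.

Lemma dotvC n (u v : 'cV[R]_n) : dotv u v = dotv v u.
Proof. by apply: eq_bigr => i _; rewrite mulrC. Qed.

Lemma dotvDr n (u v w : 'cV[R]_n) : dotv u (v + w) = dotv u v + dotv u w.
Proof. by rewrite !dotvE mulmxDr mxE. Qed.

Lemma dotvDl n (u v w : 'cV[R]_n) : dotv (v + w) u = dotv v u + dotv w u.
Proof. by rewrite dotvC dotvDr !(dotvC u). Qed.

Lemma dotvZr n (u v : 'cV[R]_n) a : dotv u (a *: v) = a * dotv u v.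
Proof. by rewrite !dotvE -scalemxAr mxE. Qed.

Lemma dotvNr n (u v : 'cV[R]_n) : dotv u (- v) = - dotv u v.
Proof. by rewrite -scaleN1r dotvZr mulN1r. Qed.

Lemma dotvZl n (u v : 'cV[R]_n) a : dotv (a *: u) v = a * dotv u v.
Proof. by rewrite dotvC dotvZr dotvC. Qed.

Lemma dotvNl n (u v : 'cV[R]_n) : dotv (- u) v = - dotv u v.
Proof. by rewrite dotvC dotvNr dotvC. Qed.

Lemma dotv0r n (u : 'cV[R]_n) : dotv u 0 = 0.
Proof. by rewrite dotvE mulmx0 mxE. Qed.

Lemma dotv_trmul m n (U : 'M[R]_(m, n)) u v :
  dotv (U^T *m u) v = dotv u (U *m v).
Proof. by rewrite !dotvE trmx_mul trmxK mulmxA. Qed.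

Lemma normr_dotv n (u v : 'cV[R]_n) : `|dotv u v| <= fnorm u * fnorm v.
Proof.
rewrite -(@ler_pXn2r _ 2)// ?nnegrE ?mulr_ge0 ?fnorm_ge0//.
rewrite real_normK ?num_real// exprMn -!dotvv; exact: cauchy_schwarz.
Qed.

Lemma fnorm_mulmxv m n (A : 'M[R]_(m, n)) (v : 'cV[R]_n) :
  fnorm (A *m v) <= fnorm A * fnorm v.
Proof.
rewrite -(@ler_pXn2r _ 2)// ?nnegrE ?mulr_ge0 ?fnorm_ge0//.
rewrite exprMn -!dotvv fnorm_sqr mulr_suml; apply: ler_sum => i _.
rewrite -expr2 mxE; exact: cauchy_schwarz.
Qed.

Lemma fnorm_sqrD n (u v : 'cV[R]_n) :
  fnorm (u + v) ^+ 2 = fnorm u ^+ 2 + 2 * dotv u v + fnorm v ^+ 2.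
Proof. rewrite -!dotvv dotvDl !dotvDr (dotvC v u); ring. Qed.

Lemma fnormZ_sqr n (v : 'cV[R]_n) a : fnorm (a *: v) ^+ 2 = a ^+ 2 * fnorm v ^+ 2.
Proof. rewrite -!dotvv dotvZr dotvC dotvZr; ring. Qed.

Lemma fnormZ n (v : 'cV[R]_n) a : 0 <= a -> fnorm (a *: v) = a * fnorm v.
Proof.
move=> a0; apply: (@pexpIrn _ 2); rewrite ?nnegrE ?mulr_ge0 ?fnorm_ge0//.
by rewrite fnormZ_sqr exprMn.
Qed.

Lemma fnorm0_eq0 n (v : 'cV[R]_n) : fnorm v = 0 -> v = 0.
Proof.
move=> /(congr1 (fun z => z ^+ 2)); rewrite -dotvv expr0n /= => h.
apply/matrixP => i j; rewrite ord1 mxE.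
have /eqP : v i 0 * v i 0 = 0.
  by apply: (psumr_eq0P _ h) => // k _; rewrite -expr2 sqr_ge0.
by rewrite mulf_eq0 orbb => /eqP.
Qed.

(** Transfers boundedness from the entrywise maximum norm to the Euclidean norm; for that purpose
    the crude factor [n] is enough. *)
Lemma fnorm_le_norm n (v : 'cV[R]_n) : fnorm v <= n%:R * `|v|.
Proof.
have v0 : 0 <= `|v| := normr_ge0 v.
rewrite -(@ler_pXn2r _ 2)// ?nnegrE ?mulr_ge0 ?fnorm_ge0//.
rewrite fnorm_sqr exprMn.
apply: (@le_trans _ _ (\sum_(i < n) `|v| ^+ 2)).
  apply: ler_sum => i _; rewrite big_ord1 -real_normK ?num_real//.
  rewrite ler_pXn2r// ?nnegrE//.
  rewrite [`|v|](_ : _ = mx_norm v)// mx_normrE.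
  exact: (le_bigmax _ (fun ij => `|v ij.1 ij.2|) (i, 0 : 'I_1)).
rewrite sumr_const card_ord -[leLHS]mulr_natl ler_wpM2r ?sqr_ge0//.
by rewrite -natrX ler_nat; case: (n) => // k; rewrite -mulnn leq_pmulr.
Qed.

End EuclideanSpace.

(** * Gradients and derivatives along lines *)

Section DirectionalDerivative.
Context {R : realType} {n : nat}.
Implicit Types (g : 'cV[R]_n -> R) (x v : 'cV[R]_n).

Lemma deriveE_gradient g x v : differentiable (g : 'cV[R]_n -> R^o) x ->
  'D_v (g : 'cV[R]_n -> R^o) x = dotv (gradient g x) v.
Proof.
move=> dg; rewrite deriveE//.
have {1}-> : v = \sum_i v i 0 *: delta_mx i 0.
  by rewrite {1}[v]matrix_sum_delta; apply: eq_bigr => i _; rewrite big_ord1.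
rewrite linear_sum; apply: eq_bigr => i _.
by rewrite linearZ /= mxE deriveE// mulrC.
Qed.

(** The difference quotient of the restriction to the line is the one defining the directional
    derivative of [g] at [x + t *: v]. *)
Lemma is_derive_line g x v (t : R) :
  differentiable (g : 'cV[R]_n -> R^o) (x + t *: v) ->
  is_derive t 1 ((fun u : R => g (x + u *: v)) : R -> R^o)
    (dotv (gradient g (x + t *: v)) v).
Proof.
move=> dg.
have E : (fun h : R => h^-1 *: (((fun u : R => g (x + u *: v) : R^o)
    \o shift t) (h *: (1 : R^o)) - g (x + t *: v)))
  = (fun h : R => h^-1 *: (((g : _ -> R^o) \o shift (x + t *: v)) (h *: v)
       - g (x + t *: v))).
  apply/funext => h /=; congr (_ *: (g _ - _)).
  by rewrite [h%:A]mulr1 scalerDl addrCA.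
apply: DeriveDef; first by rewrite /derivable E; exact: diff_derivable.
by rewrite /derive E -deriveE_gradient.
Qed.

Lemma derivable_line_cont g x v :
  (forall y, differentiable (g : 'cV[R]_n -> R^o) y) ->
  continuous (fun t : R => g (x + t *: v)).
Proof.
move=> dg t; apply: differentiable_continuous; apply/derivable1_diffP.
by have [] := is_derive_line (dg (x + t *: v)).
Qed.

Lemma gradientD g1 g2 x :
  differentiable (g1 : 'cV[R]_n -> R^o) x ->
  differentiable (g2 : 'cV[R]_n -> R^o) x ->
  gradient (g1 \+ g2) x = gradient g1 x + gradient g2 x.
Proof.
move=> d1 d2; apply/matrixP => i j; rewrite !mxE.
by rewrite (@deriveD _ _ _ (g1 : _ -> R^o))//; exact: diff_derivable.
Qed.

Lemma mean_value_line g x v : (forall y, differentiable (g : 'cV[R]_n -> R^o) y) ->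
  exists2 t : R, 0 < t < 1 &
    g (x + v) - g x = dotv (gradient g (x + t *: v)) v.
Proof.
move=> dg.
have [] := @MVT R (fun t => g (x + t *: v))
  (fun t => dotv (gradient g (x + t *: v)) v) 0 1 ltr01.
- by move=> t _; exact: is_derive_line.
- exact/continuous_subspaceT/derivable_line_cont.
move=> t; rewrite in_itv /= => t01; rewrite scale1r scale0r addr0 subr0 mulr1.
by exists t.
Qed.

End DirectionalDerivative.

(** * Convexity and first-order inequalities *)

Section Convexity.
Context {R : realType}.

Lemma segment_conv (V : lmodType R) (x v : V) (t : R) :
  t *: (x + v) + (1 - t) *: x = x + t *: v.
Proof. by rewrite scalerDr scalerBl scale1r [x - _]addrC addrACA subrr add0r addrC. Qed.

Lemma convex_function_segment n (g : 'cV[R]_n -> R) (x v : 'cV[R]_n) (t : R) :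
  @convex_function R 'cV[R]_n setT g -> 0 <= t <= 1 ->
  g (x + t *: v) <= (1 - t) * g x + t * g (x + v).
Proof.
move=> cg /andP[t0 t1].
have : g (t *: (x + v) + (1 - t) *: x) <= t * g (x + v) + (1 - t) * g x.
  by apply: (cg (Itv01 t0 t1)); rewrite inE.
by rewrite segment_conv [leRHS]addrC.
Qed.

Lemma convex_set_segment n (A : set 'cV[R]_n) (x v : 'cV[R]_n) (t : R) :
  @convex_set R 'cV[R]_n A -> 0 <= t <= 1 -> A x -> A (x + v) ->
  A (x + t *: v).
Proof.
move=> cA /andP[t0 t1] Ax Ay.
have : (t *: (x + v) + (1 - t) *: x) \in A.
  by apply: (cA (x + v) x (Itv01 t0 t1)); rewrite inE.
by rewrite inE segment_conv.
Qed.

(** The chord inequality bounds [(h t - h 0) / t] by [h 1 - h 0] for [0 < t < 1]; the bound survives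
    as [t] tends to 0. *)
Lemma derive_le_of_chord (h : R -> R) (dh : R) :
  is_derive (0 : R) 1 (h : R -> R^o) dh ->
  (forall t, 0 < t < 1 -> h t <= (1 - t) * h 0 + t * h 1) ->
  dh <= h 1 - h 0.
Proof.
move=> [dh0 <-] chord.
(* The two-sided limit is replaced by the right-hand one, since the chord inequality is known for
   positive [t] only. *)
rewrite [X in X <= _]cvg_at_rightE//; apply: limr_le.
  rewrite -(cvg_at_rightE (fun u : R =>
    u^-1 *: (((h : R -> R^o) \o shift 0) (u *: (1 : R^o)) - h 0)))//.
  apply: cvg_trans dh0; apply: cvg_app.
  move=> A [e egt0 Ae]; exists e => // z ze zgt0; apply: Ae => //.
  exact/lt0r_neq0.
near=> u.
have u0 : 0 < u by near: u; exists 1 => /=.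
have u1 : u < 1.
  near: u; exists 1 => //= z; rewrite /= sub0r normrN => z1 _.
  exact: le_lt_trans (ler_norm z) z1.
rewrite /= addr0 [u%:A]mulr1 [_ *: _]mulrC ler_pdivrMr//.
have := chord u; rewrite u0 u1 => /(_ isT); lra.
Unshelve. all: by end_near. Qed.

(** Assumes the chord inequality on a single segment, so that it serves both [F], convex everywhere,
    and [psi], convex along subspaces. *)
Lemma gradient_ineq n (g : 'cV[R]_n -> R) (x v : 'cV[R]_n) :
  differentiable (g : 'cV[R]_n -> R^o) x ->
  (forall t, 0 < t < 1 -> g (x + t *: v) <= (1 - t) * g x + t * g (x + v)) ->
  dotv (gradient g x) v <= g (x + v) - g x.
Proof.
move=> dg chord.
have := @derive_le_of_chord (fun t => g (x + t *: v)) (dotv (gradient g x) v).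
rewrite scale0r scale1r addr0; apply => //.
by have := @is_derive_line _ _ g x v 0; rewrite scale0r addr0; exact.
Qed.

End Convexity.

(** * Analysis of a single step *)

Section Step.
Context {R : realType} {n p : nat}.
Implicit Types (f psi : 'cV[R]_n -> R) (U : 'M[R]_(n, p)) (x : 'cV[R]_n)
  (d : 'cV[R]_p).

(** The residual [g] is itself taken as the direction: the model at [d + t *: g] is minimal at
    [t = 0], where its derivative is the squared norm of [g]. *)
Lemma model_stationary f psi x U H d :
  (forall y, differentiable (psi : 'cV[R]_n -> R^o) y) ->
  argmin (model f psi x U H) d ->
  U^T *m gradient f x + H *: d + U^T *m gradient psi (x + U *m d) = 0.
Proof.
move=> dpsi dmin; set g := _ + _; apply: fnorm0_eq0; apply/eqP.
rewrite -sqrf_eq0 -dotvv.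
set b := dotv (U^T *m gradient f x) g + H * dotv d g.
set y := x + U *m d.
(* [q] is the model along this direction without its [psi] term, hence a polynomial of degree at
   most two in [t]. *)
set q := fun t : R =>
  model f psi x U H d - psi y + t * b + t ^+ 2 * (H / 2 * fnorm g ^+ 2).
have qE t : model f psi x U H (d + t *: g) = q t + psi (y + t *: (U *m g)).
  rewrite /q /model /b /y mulmxDr -scalemxAr addrA fnorm_sqrD fnormZ_sqr.
  by rewrite dotvDr !dotvZr; field.
have dq : forall t : R, is_derive t 1 (q : R -> R^o)
    (b + 2 * t * (H / 2 * fnorm g ^+ 2)).
  move=> t; rewrite /q; apply: is_derive_eq.
  rewrite /GRing.scale /=; ring.
have dl : forall t : R, is_derive t 1 _ _ :=
  fun t => @is_derive_line _ _ psi y (U *m g) t (dpsi _).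
have dqt : forall t : R, is_derive t 1 _ _ :=
  fun t => @is_deriveD _ _ _ _ _ _ _ _ _ (dq t) (dl t).
have : is_derive (0 : R) (1 : R) (fun t => q t + psi (y + t *: (U *m g)) : R^o) 0.
  apply: (@derive1_at_min R _ (-1) 1); first by lra.
  - by move=> t _; have [] := dqt t.
  - by rewrite in_itv /=; lra.
  - by move=> t _; rewrite -!qE scale0r addr0; exact: dmin.
move=> [_]; have [_ ->] := dqt 0; rewrite mulr0 mul0r addr0 scale0r addr0.
by rewrite -dotv_trmul => <-; rewrite /b {1}/g !dotvDl dotvZl.
Qed.

(** Subtracting the linear and quadratic terms from [f] along the segment leaves a function [h]
    whose derivative is nonpositive on ]0, 1[ by the Lipschitz bound; the mean value theorem
    replaces the usual integral. *)
Lemma subspace_descent f U (L : R) :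
  (forall y, differentiable (f : 'cV[R]_n -> R^o) y) ->
  (forall x (h : 'cV[R]_p),
    fnorm (U^T *m (gradient f (x + U *m h) - gradient f x)) <= L * fnorm h) ->
  forall x d, f (x + U *m d) <=
    f x + dotv (U^T *m gradient f x) d + L / 2 * fnorm d ^+ 2.
Proof.
move=> df lip x d; set a := dotv _ d; set c := L / 2 * _.
set h := fun t : R => f (x + t *: (U *m d)) - t * a - t ^+ 2 * c.
have dh : forall t : R, is_derive t 1 (h : R -> R^o)
    (dotv (gradient f (x + t *: (U *m d))) (U *m d) - a - 2 * t * c).
  move=> t; have ? := @is_derive_line _ _ f x (U *m d) t (df _).
  rewrite /h; apply: is_derive_eq; rewrite /GRing.scale /=; ring.
have ch : continuous h.
  move=> t; apply: differentiable_continuous; apply/derivable1_diffP.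
  by have [] := dh t.
have [t t01] := @MVT R h _ 0 1 ltr01 (fun t _ => dh t) (continuous_subspaceT ch).
rewrite /h scale1r scale0r addr0 => E.
suff : dotv (gradient f (x + t *: (U *m d))) (U *m d) - a - 2 * t * c <= 0 by lra.
move: t01; rewrite in_itv /= => /andP[t0 t1].
rewrite /a -dotv_trmul -dotvNl -dotvDl -mulmxBr scalemxAr.
have := lip x (t *: d); rewrite (fnormZ _ (ltW t0)) => lipt.
have := le_trans (ler_norm _) (normr_dotv
  (U^T *m (gradient f (x + U *m (t *: d)) - gradient f x)) d).
have := ler_wpM2r (fnorm_ge0 d) lipt; rewrite /c; lra.
Qed.

(** If [psi] is convex along the subspaces, stationarity and the gradient inequality at the new
    point gain the full [Hf * fnorm d ^+ 2]; otherwise comparing the model at [d] and at 0 gains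
    half of it. The two values of [Hf] make both gains equal to [(L U + eta) / 2 * fnorm d ^+ 2]. *)
Lemma scpg_step_descent f psi (calU : set 'M[R]_(n, p)) L x U eta d :
  assumptionA f psi calU L -> calU U ->
  argmin (model f psi x U (Hf psi calU L U eta)) d ->
  (f \+ psi) (x + U *m d) <= (f \+ psi) x - eta / 2 * fnorm d ^+ 2.
Proof.
move=> [_ [df _] lip [[dpsi _] _] _] UU dmin.
have := subspace_descent df (lip U UU) x d; set a := dotv _ d => desc /=.
move: dmin; rewrite /Hf; case: asboolP => cpsi dmin.
  have st := model_stationary dpsi dmin.
  have := @gradient_ineq _ _ psi (x + U *m d) (- (U *m d)) (dpsi _).
  rewrite addrK.
  have chord (t : R) : 0 < t < 1 -> psi (x + U *m d + t *: - (U *m d))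
      <= (1 - t) * psi (x + U *m d) + t * psi x.
    move=>  /andP[t0 t1].
    have := @convex_function_segment _ _ _ d (- d) t (cpsi x U UU).
    rewrite (ltW t0) (ltW t1) subrr mulmx0 addr0 mulmxDr addrA => /(_ isT).
    by rewrite -scalemxAr mulmxN.
  move=> /(_ chord); rewrite dotvNr -dotv_trmul.
  have : dotv (U^T *m gradient psi (x + U *m d)) d
         = - a - (L U + eta) / 2 * fnorm d ^+ 2.
    move/(congr1 (fun w : 'cV[R]_p => dotv w d)): st; rewrite !dotvDl dotvZl dotvv -/a.
    rewrite [dotv 0 d]dotvC dotv0r; lra.
  move=> ->; lra.
have := dmin 0; rewrite /model mulmx0 addr0 -/a.
rewrite -[in fnorm 0 ^+ 2]dotvv !dotv0r; lra.
Qed.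

(** Stationarity involves the gradient of [psi] at the new point. Going back to [x] costs a Hessian
    times [U *m d], where the mean value theorem yields a different intermediate point for each row:
    hence [row_hessian]. *)
Lemma scpg_step_gradient f psi x0 x U H d (M : R) :
  (forall y, differentiable (f : 'cV[R]_n -> R^o) y) -> C2 psi ->
  argmin (model f psi x U H) d ->
  sublevel (f \+ psi) x0 x -> sublevel (f \+ psi) x0 (x + U *m d) ->
  (HF f psi x0 U H <= M%:E)%E ->
  fnorm (U^T *m gradient (f \+ psi) x) <= M * fnorm d.
Proof.
move=> df [[dpsi _] dhess] dmin sx sxd HFM.
have mv i : exists2 z, conv_hull (sublevel (f \+ psi) x0) z &
    gradient psi (x + U *m d) i 0 - gradient psi x i 0
    = dotv (gradient (fun y => gradient psi y i 0) z) (U *m d).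
  have [t /andP[t0 t1] E] := mean_value_line x (U *m d) (proj1 (dhess i)).
  (* Any convex set containing the sublevel set contains both endpoints, hence the intermediate
     point. *)
  exists (x + t *: (U *m d)) => // A [cA sA].
  by apply: convex_set_segment => //; [rewrite !ltW|exact: sA|exact: sA].
have /choice[z /all_and2[zh zE]] : forall i, exists z,
    conv_hull (sublevel (f \+ psi) x0) z /\
    gradient psi (x + U *m d) i 0 - gradient psi x i 0
    = dotv (gradient (fun y => gradient psi y i 0) z) (U *m d).
  by move=> i; have [z ? ?] := mv i; exists z.
have gE : gradient psi (x + U *m d) - gradient psi x = row_hessian psi z *m (U *m d).
  apply/matrixP => i j; rewrite ord1; transitivity
    (gradient psi (x + U *m d) i 0 - gradient psi x i 0); first by rewrite !mxE.
  by rewrite zE mxE; apply: eq_bigr => k _; rewrite !mxE.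
have st := model_stationary dpsi dmin.
have -> : U^T *m gradient (f \+ psi) x
    = - ((U^T *m row_hessian psi z *m U + H%:M) *m d).
  rewrite gradientD// mulmxDr mulmxDl -!mulmxA -gE mul_scalar_mx mulmxBr.
  apply/eqP; rewrite -subr_eq0 opprK -st; apply/eqP.
  by rewrite addrACA [_ + H *: d]addrC; apply/matrixP => i j; rewrite !mxE; ring.
rewrite fnormN; apply: le_trans (fnorm_mulmxv _ _) _.
apply: ler_wpM2r; first exact: fnorm_ge0.
rewrite -lee_fin; apply: le_trans HFM; apply: ereal_sup_ubound.
by exists z.
Qed.

End Step.

(** * The scalar recurrence *)

(* Stated without dividing by D, which vanishes when HFmax = 0 (where the rate
   constant is the junk value 0) or when the level radius is 0. *)
Lemma mul_count_le (R : realFieldType) (e : nat -> R) (W : pred nat) (D : R) :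
  0 <= D -> (forall k, 0 <= e k) -> (forall k, e k.+1 <= e k) ->
  (forall k, W k -> e k ^+ 2 <= D * (e k - e k.+1)) ->
  forall k, e k * (\sum_(j < k) W j)%:R <= D.
Proof.
move=> D0 e0 edec eW; elim=> [|k IH]; first by rewrite big_ord0 mulr0.
rewrite big_ord_recr /=; set N := (\sum_(j < k) W j)%N in IH *.
have N0 : 0 <= N%:R :> R by [].
case: (boolP (W k)) => Wk; last first.
  by rewrite addn0; apply: le_trans IH; rewrite ler_wpM2r.
rewrite addn1 -natr1; move: N%:R N0 IH => {}N N0 IH.
have := e0 k; have := e0 k.+1; have := edec k; have := eW k Wk.
move: (e k) (e k.+1) IH => a b IH h1 ba b0 a0.
have [Dz|Dnz] := eqVneq D 0.
  have az : a = 0 by apply/eqP; rewrite -sqrf_eq0 eq_le sqr_ge0 andbT; nra.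
  by have -> : b = 0; [lra|rewrite mul0r].
have Dpos : 0 < D by rewrite lt_def Dnz.
(* From [a * b <= a ^+ 2 <= D * (a - b)]; in terms of inverses, [1 / b] exceeds [1 / a] by at least
   [1 / D]. *)
have h2 : b * (D + a) <= D * a by nra.
rewrite -(@ler_pM2r _ (D + a)); last by lra.
apply: (@le_trans _ _ ((N + 1) * (D * a))).
  by rewrite mulrAC mulrC; apply: ler_wpM2l; lra.
nra.
Qed.

(** * Optimality gap and level radius *)

Section LevelRadius.
Context {R : realType} {n : nat}.
Implicit Types (F : 'cV[R]_n -> R) (x y : 'cV[R]_n).

Let dist F y := inf [set fnorm (y - xs) | xs in argmin F].

Lemma dist_has_inf F y : argmin F !=set0 ->
  has_inf [set fnorm (y - xs) | xs in argmin F].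
Proof.
move=> [xs Fxs]; split; first by exists (fnorm (y - xs)), xs.
by exists 0 => _ [z _ <-]; exact: fnorm_ge0.
Qed.

(** Boundedness of the sublevel set bounds the distances from above, so that [sup] is a genuine
    supremum and not its default value. *)
Lemma dist_le_level_radius F x0 y :
  argmin F !=set0 -> bounded_set (sublevel F x0) -> sublevel F x0 y ->
  dist F y <= level_radius F x0.
Proof.
move=> hF [M [_ hM]] sy; apply: ub_le_sup; last by exists y.
have [xs Fxs] := hF.
exists (n%:R * (M + 1 + `|xs|)) => _ [z sz <-].
apply: (@le_trans _ _ (fnorm (z - xs))).
  by apply: ge_inf; [exact: (dist_has_inf z hF).2|exists xs].
apply: le_trans (fnorm_le_norm _) _; rewrite ler_wpM2l//.
apply: le_trans (ler_normB _ _) _; rewrite lerD2r.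
by apply: (hM (M + 1)) => //; rewrite ltrDl.
Qed.

(** The gradient inequality and Cauchy-Schwarz bound the gap through the distance to each minimizer;
    then the infimum over minimizers is taken. *)
Lemma convex_gap_le F x0 x xs :
  (forall y, differentiable (F : 'cV[R]_n -> R^o) y) ->
  @convex_function R 'cV[R]_n setT F ->
  bounded_set (sublevel F x0) -> sublevel F x0 x -> argmin F xs ->
  F x - F xs <= level_radius F x0 * fnorm (gradient F x).
Proof.
move=> dF cF bF sx Fxs.
have hF : argmin F !=set0 by exists xs.
have gap z : argmin F z -> F x - F xs <= fnorm (gradient F x) * fnorm (x - z).
  move=> Fz; have := @gradient_ineq _ _ F x (z - x) (dF x).
  have -> : x + (z - x) = z by rewrite addrC subrK.
  have chord (t : R) : 0 < t < 1 ->
      F (x + t *: (z - x)) <= (1 - t) * F x + t * F z.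
    move=> /andP[t0 t1]; have -> : F z = F (x + (z - x)) by rewrite addrC subrK.
    by apply: convex_function_segment => //; rewrite !ltW.
  move=> /(_ chord).
  have := le_trans (ler_norm _) (normr_dotv (gradient F x) (x - z)).
  have := Fz xs; rewrite -[x - z]opprB dotvNr fnormN; lra.
rewrite mulrC; apply: le_trans (ler_wpM2l (fnorm_ge0 _) (dist_le_level_radius hF bF sx)).
(* Passing to the infimum divides by the gradient norm; when that norm is 0 the gap is already
   nonpositive. *)
have [G0|Gnz] := eqVneq (fnorm (gradient F x)) 0.
  by have := gap _ Fxs; rewrite G0 !mul0r.
have Gpos : 0 < fnorm (gradient F x) by rewrite lt_def Gnz fnorm_ge0.
rewrite mulrC -ler_pdivrMr//; apply: lb_le_inf.
  exact: (dist_has_inf x hF).1.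
by move=> _ [z Fz <-]; rewrite ler_pdivrMr// mulrC; exact: gap.
Qed.

End LevelRadius.

(** * A Chernoff bound for conditionally likely events *)

(** The difference of the two sides vanishes at 0 and has derivative [1 - u - expR (- u)],
    nonpositive by the tangent bound on [expR]. *)
Lemma expRN_le (R : realType) (t : R) : 0 <= t -> expR (- t) <= 1 - t + t ^+ 2 / 2.
Proof.
rewrite le_eqVlt => /predU1P[<-|t0].
  rewrite oppr0 expR0; lra.
set h := fun u : R => expR (- u) - (1 - u + u ^+ 2 / 2).
have dh : forall u : R, is_derive u (1 : R) (h : R -> R^o) (- expR (- u) - (- 1 + u)).
  by move=> u; rewrite /h; apply: is_derive_eq; rewrite /GRing.scale /=; field.
have ch : continuous h.
  move=> u; apply: differentiable_continuous; apply/derivable1_diffP.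
  by have [] := dh u.
have [u _ E] := @MVT R h _ 0 t t0 (fun u _ => dh u) (continuous_subspaceT ch).
have : h t - h 0 <= 0.
  by rewrite E; apply: mulr_le0_ge0; [have := expR_ge1Dx (- u); lra|lra].
rewrite /h oppr0 expR0; lra.
Qed.

Section Chernoff.
Context {R : realType} {d : measure_display} {Omega : measurableType d}.
Variables (P : probability Omega R) (S : nat -> set (set Omega))
  (W : nat -> set Omega) (delta : R).

(** The window starts at an arbitrary [k] because the induction on its length [r] removes its first
    index. *)
Definition nb_events k r (w : Omega) : nat := \sum_(k <= j < k + r) (w \in W j).

Let few k r (m : R) : set Omega := [set w | (nb_events k r w)%:R < m].

Let few0 k m A : 0 < m -> A `&` few k 0 m = A.
Proof.
move=> m0; apply/seteqP; split => w /=; first by case.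
by move=> Aw; split=> //; rewrite /few /nb_events /= addn0 big_geq.
Qed.

Let few0_set0 k m A : m <= 0 -> A `&` few k 0 m = set0.
Proof.
move=> m0; apply/seteqP; split => w //= [_].
by rewrite /few /nb_events /= addn0 big_geq// ltNge m0.
Qed.

Let fewS k r m A : A `&` few k r.+1 m =
  ((A `&` W k) `&` few k.+1 r (m - 1)) `|` ((A `\` W k) `&` few k.+1 r m).
Proof.
have E w : nb_events k r.+1 w = ((w \in W k) + nb_events k.+1 r w)%N.
  by rewrite /nb_events big_ltn ?addSnnS// -addSnnS leq_addr.
apply/seteqP; split => w /=.
  rewrite /few /= E => -[Aw]; case: (boolP (w \in W k)) => [/set_mem|/negP] Wk.
    by rewrite natrD /= => ?; left; split=> //; lra.
  by right; do 2!split=> //; move=> /mem_set.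
rewrite /few /= E => -[[[Aw Ww]]|[[Aw Ww]]].
  by rewrite (mem_set Ww) natrD /= => ?; split=> //; lra.
by rewrite (memNset Ww).
Qed.

Hypothesis S_meas : forall k, S k `<=` measurable.
Hypothesis S_next : forall k, S k `<=` S k.+1.
Hypothesis S_setI : forall k A B, S k A -> S k B -> S k (A `&` B).
Hypothesis S_setD : forall k A B, S k A -> S k B -> S k (A `\` B).
Hypothesis S_W : forall k, S k.+1 (W k).
Hypothesis cond_W : forall k A, S k A -> ((1 - delta)%:E * P A <= P (A `&` W k))%E.

Lemma measurable_nb_events_lt k r m A : measurable A ->
  measurable (A `&` [set w | (nb_events k r w)%:R < m :> R]).
Proof.
elim: r k m A => [|r IH] k m A mA.
  by have [m0|m0] := ltP 0 m; [rewrite few0|rewrite few0_set0].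
have mW := S_meas (S_W k).
by rewrite fewS; apply: measurableU; apply: IH;
  [exact: measurableI|exact: measurableD].
Qed.

Let pr A : R := fine (P A).

Let prE A : measurable A -> P A = (pr A)%:E.
Proof. by move=> mA; rewrite fineK// fin_num_measure. Qed.

(* Splitting A along W k leaves both parts in S k.+1, so the exponential moment
   bound propagates by induction on r without any integral. *)
Lemma chernoff_cond k r m t A : 0 <= t -> delta <= 1 -> 0 <= delta -> S k A ->
  fine (P (A `&` [set w | (nb_events k r w)%:R < m])) <=
  fine (P A) * (expR (t * m) * (1 - (1 - delta) * (1 - expR (- t))) ^+ r).
Proof.
move=> t0 d1 d0; rewrite -/(pr _) -/(pr _).
set rho := 1 - _.
have et1 : expR (- t) <= 1 by rewrite expR_le1 oppr_le0.
have et0 := expR_ge0 (- t).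
have rho0 : 0 <= rho by rewrite /rho; nra.
elim: r k m A => [|r IH] k m A SA; have mA := S_meas SA;
  have prA : 0 <= pr A by rewrite -lee_fin -prE.
  (* For an empty window the count is 0: the event is [A] if [m] is positive, where [expR (t * m)]
     is at least 1, and empty otherwise. *)
  have [m0|m0] := ltP 0 m.
    by rewrite few0// expr0 mulr1 ler_peMr// -expR0 ler_expR mulr_ge0// ltW.
  by rewrite few0_set0// /pr measure0 mulr_ge0// mulr_ge0// ?exprn_ge0// expR_ge0.
have mW := S_meas (S_W k).
have mAW : measurable (A `&` W k) by exact: measurableI.
have mAD : measurable (A `\` W k) by exact: measurableD.
have -> : pr (A `&` few k r.+1 m) =
    pr ((A `&` W k) `&` few k.+1 r (m - 1)) + pr ((A `\` W k) `&` few k.+1 r m).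
  apply: EFin_inj; rewrite EFinD -!prE; try exact: measurable_nb_events_lt.
  rewrite fewS measureU//; try exact: measurable_nb_events_lt.
  by apply/seteqP; split => w //= [[[_ ?] _] [[_ ?] _]].
have SA' := S_next SA.
have h1 := IH k.+1 (m - 1) _ (S_setI SA' (S_W k)).
have h2 := IH k.+1 m _ (S_setD SA' (S_W k)).
apply: le_trans (lerD h1 h2) _.
have prD : pr (A `\` W k) = pr A - pr (A `&` W k).
  apply/eqP; rewrite eq_sym subr_eq; apply/eqP/EFin_inj.
  rewrite EFinD -!prE// addeC -measureU//; first by rewrite setUIDK.
  by apply/seteqP; split => w //= [[_ ?] [_ ?]].
have cW : (1 - delta) * pr A <= pr (A `&` W k).
  by rewrite -lee_fin EFinM -!prE//; exact: cond_W.
have -> : t * (m - 1) = t * m + - t by ring.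
rewrite expRD prD exprS.
have c0 : 0 <= expR (t * m) * rho ^+ r by rewrite mulr_ge0 ?expR_ge0 ?exprn_ge0.
(* The sum of the two bounds is nonincreasing in [pr (A]&[W k)], so the worst case is its lower
   bound [(1 - delta) * pr A], which produces the next factor [rho]. *)
have : 0 <= (expR (t * m) * rho ^+ r) *
  ((1 - expR (- t)) * (pr (A `&` W k) - (1 - delta) * pr A)).
  by rewrite mulr_ge0// mulr_ge0; lra.
rewrite /rho; move: (rho ^+ r) (expR _) => a b; lra.
Qed.

Lemma chernoff_nb_events beta r : 0 < beta < 1 -> 0 < delta < 1 -> S 0%N setT ->
  (P [set w | (nb_events 0 r w)%:R < (1 - beta) * ((1 - delta) * r%:R)]%R
   <= (expR (- (beta ^+ 2 / 2) * (1 - delta) * r%:R))%:E)%E.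
Proof.
move=> /andP[b0 b1] /andP[d0 d1] ST.
set m := (1 - beta) * _.
rewrite -[X in P X]setTI prE; last exact: measurable_nb_events_lt.
rewrite lee_fin.
(* The choice t = beta of the exponent is suboptimal, but already gives
   beta ^ 2 / 2 through exp(- t) <= 1 - t + t ^ 2 / 2. *)
apply: le_trans (chernoff_cond r m (ltW b0) (ltW d1) (ltW d0) ST) _.
rewrite probability_setT /= mul1r.
set x := (1 - delta) * _.
have x1 : 0 <= 1 - x.
  have := expR_ge0 (- beta).
  have : expR (- beta) <= 1 by rewrite expR_le1 oppr_le0 ltW.
  by rewrite /x; nra.
have h : (1 - x) ^+ r <= expR (- x * r%:R).
  rewrite mulrC expRM_natl lerXn2r ?nnegrE ?expR_ge0//; exact: expR_ge1Dx.
apply: le_trans (ler_wpM2l (expR_ge0 _) h) _.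
(* Per unit of [(1 - delta) * r%:R] the exponent is [beta * (1 - beta) - (1 - expR (- beta))], at
   most [- (beta ^+ 2 / 2)]. *)
rewrite -expRD ler_expR /m /x.
have r0 : 0 <= (1 - delta) * r%:R by rewrite mulr_ge0//; lra.
have := ler_wpM2l r0 (expRN_le (ltW b0)).
lra.
Qed.

End Chernoff.

(** * Measurability of continuous functions of random vectors *)

Lemma cvg_grid_floor (R : realType) n (v : 'cV[R]_n) :
  (fun m : nat => \col_i ((Num.floor (m.+1%:R * v i 0))%:~R / m.+1%:R)
    : 'cV[R]_n) @ \oo --> v.
Proof.
apply/cvgrPdist_lt => e e0.
near=> m.
apply: (@le_lt_trans _ _ (m.+1%:R^-1)); last first.
  by near: m; exact: (near_infty_natSinv_lt (PosNum e0)).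
set u := v - _; rewrite [`|u|](_ : _ = mx_norm u)// mx_normrE.
apply/bigmax_leP; split=> [|[i j] _ /=]; first by rewrite invr_ge0.
rewrite ord1 /u !mxE.
have m0 : 0 < m.+1%:R :> R by [].
rewrite -(@ler_pM2l _ m.+1%:R)// -{1}[m.+1%:R]ger0_norm// -normrM mulrBr mulfV ?gt_eqF//.
rewrite [X in _ - X]mulrC divfK ?gt_eqF//.
have /andP[f1 f2] := floor_itv (m.+1%:R * v i 0).
rewrite ger0_norm ?subr_ge0//; rewrite intrD in f2; lra.
Unshelve. all: by end_near. Qed.

(** Rounding [y] down to the grid of mesh [1 / m.+1] gives maps with countably many values; by
    continuity [g \o y] is the pointwise limit of [g] at the rounded vectors. *)
Lemma measurable_continuous_mx d (T : measurableType d) (R : realType) n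
    (g : 'cV[R]_n -> R) (y : T -> 'cV[R]_n) :
  continuous g -> (forall i, measurable_fun setT (fun w => y w i 0)) ->
  measurable_fun setT (g \o y).
Proof.
move=> cg my.
apply: (@measurable_fun_cvg _ _ _ setT (fun m w => g
  (\col_i ((Num.floor (m.+1%:R * y w i 0))%:~R / m.+1%:R)))); last first.
  move=> w _; apply: continuous_cvg; first exact: cg.
  exact: cvg_grid_floor.
move=> m _ B mB; rewrite setTI.
(* [F z] is the event that [y] falls in the grid cell of [z], kept only if the value of [g] at the
   grid point lies in [B]. *)
pose F (z : 'cV[int]_n) : set T :=
  [set w | B (g (\col_i ((z i 0)%:~R / m.+1%:R)))] `&`
  \bigcap_(i in [set: 'I_n]) ((fun w => m.+1%:R * y w i 0) @^-1`
     `[(z i 0)%:~R, (z i 0 + 1)%:~R[).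
rewrite [X in measurable X](_ : _ = \bigcup_z F z).
  apply: countable_bigcupT_measurable => [|z]; first exact: countableP.
  apply: measurableI.
    have [h|h] := pselect (B (g (\col_i ((z i 0)%:~R / m.+1%:R)))).
      rewrite [X in measurable X](_ : _ = setT); first exact: measurableT.
      by apply/seteqP; split.
    rewrite [X in measurable X](_ : _ = set0); first exact: measurable0.
    by apply/seteqP; split.
  apply: fin_bigcap_measurable => [|i _]; first exact: finite_finset.
  rewrite -[X in measurable X]setTI.
  by apply: (measurable_funM (measurable_cst _) (my i)) => //; exact: measurable_itv.
apply/seteqP; split => w /=.
  move=> Bw; exists (\col_i Num.floor (m.+1%:R * y w i 0)) => //; split => /=.
    by move: Bw; congr (B (g _)); apply/matrixP => i j; rewrite !mxE.
  by move=> i _; rewrite /= in_itv /= !mxE floor_itv.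
move=> [z _ [/= Bz zi]]; move: Bz; congr (B (g _)).
apply/matrixP => i j; rewrite !mxE; congr (_%:~R / _).
by apply/esym/eqP; rewrite floor_eq; have := zi i Logic.I; rewrite /= in_itv.
Qed.

(** * The filtration and adaptedness *)

Section Past.
Context {R : realType} {n p : nat} {d : measure_display} {Omega : measurableType d}.
Implicit Types (U : nat -> Omega -> 'M[R]_(n, p)).

Definition past_gen U (k : nat) : set (set Omega) :=
  [set A | exists j i l, (j < k)%N /\
     preimage_set_system setT (fun w => U j w i l) measurable A].

(** Viewing [past U k] as the sigma-algebra of a measurable type makes the closure properties of
    measurable functions available for adaptedness. *)
Definition past_measurable U k (h : Omega -> R) : Prop :=
  measurable_fun setT (h : g_sigma_algebraType (past_gen U k) -> R).

Lemma past_measurableP U k h :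
  past_measurable U k h <-> (forall B, measurable B -> past U k (h @^-1` B)).
Proof.
split=> [mh B mB|mh _ B mB]; last by rewrite setTI; exact: mh.
by have := mh measurableT B mB; rewrite setTI.
Qed.

Lemma past_le U k k' : (k <= k')%N -> past U k `<=` past U k'.
Proof.
move=> kk'; apply: sub_sigma_algebra2 => A [j [i [l [jk hA]]]].
by exists j, i, l; split=> //; exact: leq_trans kk'.
Qed.

Lemma past_measurable_le U k k' h : (k <= k')%N ->
  past_measurable U k h -> past_measurable U k' h.
Proof.
move=> kk' /past_measurableP mh; apply/past_measurableP => B mB.
exact: past_le (mh B mB).
Qed.

Lemma past_measurable_sample U k i l : past_measurable U k.+1 (fun w => U k w i l).
Proof.
apply/past_measurableP => B mB; apply: sub_sigma_algebra.
by exists k, i, l; split=> //; exists B => //; rewrite setTI.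
Qed.

Lemma past_sub_measurable U k :
  (forall k i j, measurable_fun setT (fun w => U k w i j)) ->
  past U k `<=` measurable.
Proof.
move=> mU; apply: smallest_sub; first exact: sigma_algebra_measurable.
by move=> A [j [i [l [_ [B mB <-]]]]]; exact: mU.
Qed.

End Past.

Section IterateMeasurable.
Context {R : realType} {n p : nat} {d : measure_display} {Omega : measurableType d}.
Variables (f psi : 'cV[R]_n -> R) (calU : set 'M[R]_(n, p))
  (L : 'M[R]_(n, p) -> R) (x0 : 'cV[R]_n) (U : nat -> Omega -> 'M[R]_(n, p))
  (eta : nat -> Omega -> R) (s : nat -> Omega -> 'cV[R]_p)
  (x : nat -> Omega -> 'cV[R]_n).
Hypothesis halg : scpg f psi calU L x0 U eta s x.

Lemma iterate_past_measurable k i : past_measurable U k (fun w => x k w i 0).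
Proof.
elim: k i => [|k IH] i.
  rewrite (_ : (fun w => _) = cst (x0 i 0)); first exact: measurable_cst.
  by apply/funext => w; rewrite (Defs.iter0 halg).
rewrite (_ : (fun w => _) =
    (fun w => x k w i 0 + \sum_j U k w i j * s k w j 0)).
  apply: measurable_funD; first exact: past_measurable_le (leqnSn k) (IH i).
  apply: measurable_sum => j; apply: measurable_funM.
    exact: past_measurable_sample.
  by apply/past_measurableP => B mB; exact: (step_adapted halg).
by apply/funext => w; rewrite (Defs.iterS halg) !mxE.
Qed.

(** Squaring both nonnegative sides turns alignment into a comparison of polynomials in the entries
    of [U k] and of the gradient at [x k]. The event belongs to the past at [k.+1], as it depends on
    [U k]. *)
Lemma well_aligned_past (F : 'cV[R]_n -> R) alpha k : 0 <= alpha ->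
  continuous (gradient F) ->
  past U k.+1 (well_aligned F alpha U x k).
Proof.
move=> a0 cF.
have mgrad i : past_measurable U k.+1 (fun w => gradient F (x k w) i 0).
  apply: (@measurable_continuous_mx _ (g_sigma_algebraType (past_gen U k.+1))
    _ _ (fun y => gradient F y i 0) (x k)).
    move=> y; apply: (@continuous_comp _ _ _ (gradient F) (fun v : 'cV[R]_n => v i 0)).
      exact: cF.
    exact: coord_continuous.
  by move=> j; exact: past_measurable_le (leqnSn k) (iterate_past_measurable j).
have m1 : past_measurable U k.+1
    (fun w => alpha ^+ 2 * \sum_i gradient F (x k w) i 0 ^+ 2).
  apply: measurable_funM; first exact: measurable_cst.
  by apply: measurable_sum => i; apply: measurable_funX; exact: mgrad.
have m2 : past_measurable U k.+1
    (fun w => \sum_j (\sum_i U k w i j * gradient F (x k w) i 0) ^+ 2).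
  apply: measurable_sum => j; apply: measurable_funX.
  apply: measurable_sum => i; apply: measurable_funM; last exact: mgrad.
  exact: past_measurable_sample.
have /(_ measurableT [set true] Logic.I) := measurable_fun_ler m1 m2.
rewrite setTI; congr (past U k.+1 _); apply/funext => w; apply/propext.
rewrite /well_aligned /=.
have -> : \sum_i gradient F (x k w) i 0 ^+ 2 = fnorm (gradient F (x k w)) ^+ 2.
  by rewrite -dotvv; apply: eq_bigr => i _; rewrite expr2.
have -> : \sum_j (\sum_i U k w i j * gradient F (x k w) i 0) ^+ 2
   = fnorm ((U k w)^T *m gradient F (x k w)) ^+ 2.
  rewrite -dotvv; apply: eq_bigr => i _; rewrite -expr2 mxE; congr (_ ^+ 2).
  by apply: eq_bigr => j _; rewrite [_^T _ _]mxE.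
by rewrite -exprMn ler_pXn2r// nnegrE ?mulr_ge0 ?fnorm_ge0.
Qed.

End IterateMeasurable.

(** * Deterministic estimates along a run *)

Section Trajectory.
Context {R : realType} {n p : nat} {d : measure_display} {Omega : measurableType d}.
Variables (f psi : 'cV[R]_n -> R) (calU : set 'M[R]_(n, p))
  (L : 'M[R]_(n, p) -> R) (x0 : 'cV[R]_n) (U : nat -> Omega -> 'M[R]_(n, p))
  (eta : nat -> Omega -> R) (s : nat -> Omega -> 'cV[R]_p)
  (x : nat -> Omega -> 'cV[R]_n).
Hypothesis hA : assumptionA f psi calU L.
Hypothesis halg : scpg f psi calU L x0 U eta s x.
Hypothesis heta_min : 0 < eta_inf eta.

Let F := f \+ psi.

Lemma eta_inf_le k w : eta_inf eta <= eta k w.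
Proof.
apply: ge_inf; last by exists k => //; exists w.
by exists 0 => _ [j _ [v _ <-]]; exact: ltW (eta_gt0 halg _ _).
Qed.

Lemma scpg_descent k w :
  F (x k.+1 w) <= F (x k w) - eta_inf eta / 2 * fnorm (s k w) ^+ 2.
Proof.
rewrite (Defs.iterS halg).
apply: le_trans (scpg_step_descent hA (sample_in halg k w) (step_argmin halg k w)) _.
have := ler_wpM2r (sqr_ge0 (fnorm (s k w))) (eta_inf_le k w); rewrite /F; lra.
Qed.

Lemma scpg_decreasing k w : F (x k.+1 w) <= F (x k w).
Proof.
apply: le_trans (scpg_descent k w) _.
have : 0 <= eta_inf eta / 2 * fnorm (s k w) ^+ 2.
  by rewrite mulr_ge0 ?sqr_ge0 ?divr_ge0 ?ltW.
lra.
Qed.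

Lemma scpg_sublevel k w : sublevel F x0 (x k w).
Proof.
elim: k => [|k IH]; first by rewrite (Defs.iter0 halg) /sublevel /=.
exact: le_trans (scpg_decreasing k w) IH.
Qed.

Lemma differentiable_objective y : differentiable (F : 'cV[R]_n -> R^o) y.
Proof.
apply: (@differentiableD _ _ _ (f : _ -> R^o)).
  exact: (smooth_f hA).1.
exact: (smooth_psi hA).1.1.
Qed.

Lemma continuous_gradient_objective : continuous (gradient F).
Proof.
have -> : gradient F = (fun y => gradient f y + gradient psi y).
  apply/funext => y; apply: gradientD; first exact: (smooth_f hA).1.
  exact: (smooth_psi hA).1.1.
by move=> y; exact: cvgD ((smooth_f hA).2 y) ((smooth_psi hA).1.2 y).
Qed.

Variables (alpha HFmax : R) (xstar : 'cV[R]_n).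
Hypothesis halpha : 0 < alpha.
Hypothesis hbounded : bounded_set (sublevel F x0).
Hypothesis hconvex : @convex_function R 'cV[R]_n setT F.
Hypothesis hHFmax : forall k w,
  (HF f psi x0 (U k w) (Hf psi calU L (U k w) (eta k w)) <= HFmax%:E)%E.
Hypothesis hxstar : argmin F xstar.

Let W := well_aligned F alpha U x.

Lemma scpg_gap_mul_count w k :
  (F (x k w) - F xstar) * (nb_events W 0 k w)%:R <=
  1 / rateC alpha (eta_inf eta) HFmax * level_radius F x0 ^+ 2.
Proof.
(* Inverting the fraction is valid even for [HFmax = 0], where both sides are 0; afterwards only
   [alpha ^+ 2 * eta_inf eta], which is positive, is a denominator. *)
rewrite /rateC mul1r invf_div /nb_events add0n big_mkord.
apply: (@mul_count_le R (fun j => F (x j w) - F xstar) (fun j => w \in W j)).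
- apply: mulr_ge0 (sqr_ge0 _); apply: divr_ge0; apply: mulr_ge0 => //.
  + exact: sqr_ge0.
  + exact: sqr_ge0.
  + exact: ltW.
- by move=> j; rewrite subr_ge0; exact: hxstar.
- by move=> j; rewrite lerD2r; exact: scpg_decreasing.
move=> j /set_mem Wj; rewrite opprB addrA subrK.
have hd : eta_inf eta / 2 * fnorm (s j w) ^+ 2 <= F (x j w) - F (x j.+1 w).
  have := scpg_descent j w; lra.
have hg : fnorm ((U j w)^T *m gradient F (x j w)) <= HFmax * fnorm (s j w).
  apply: scpg_step_gradient (step_argmin halg j w) _ _ (hHFmax j w).
  - exact: (smooth_f hA).1.
  - exact: smooth_psi hA.
  - exact: scpg_sublevel.
  - by rewrite -(Defs.iterS halg); exact: scpg_sublevel.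
have he := convex_gap_le differentiable_objective hconvex hbounded
  (scpg_sublevel j w) hxstar.
have e0 : 0 <= F (x j w) - F xstar by rewrite subr_ge0; exact: hxstar.
have a2 : 0 < alpha ^+ 2 * eta_inf eta by rewrite mulr_gt0// exprn_gt0.
have aG := le_trans Wj hg.
have aG0 : 0 <= alpha * fnorm (gradient F (x j w)) by rewrite mulr_ge0 ?fnorm_ge0// ltW.
move: (F (x j w) - F xstar) e0 he => e e0 he.
move: (F (x j w) - F (x j.+1 w)) hd => D hd.
move: (fnorm (gradient F (x j w))) (fnorm (s j w)) (level_radius F x0)
  (eta_inf eta) heta_min he hd aG aG0 a2 => G N r h h0 he hd aG aG0 a2.
rewrite (mulrAC (2 * _)) (mulrAC (2 * _ * _)) ler_pdivlMr//.
(* The gap, alignment and descent bounds are chained in squared form: gap by gradient, gradient by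
   step length, step length by decrease. *)
have e2 : e ^+ 2 <= (r * G) ^+ 2.
  by rewrite ler_pXn2r// nnegrE//; exact: le_trans e0 he.
have a2G : (alpha * G) ^+ 2 <= (HFmax * N) ^+ 2.
  by rewrite ler_pXn2r// nnegrE//; exact: le_trans aG0 aG.
apply: (@le_trans _ _ ((r * G) ^+ 2 * (alpha ^+ 2 * h))).
  by rewrite ler_wpM2r// ltW.
apply: (@le_trans _ _ (r ^+ 2 * h * (HFmax * N) ^+ 2)).
  rewrite (_ : (r * G) ^+ 2 * _ = r ^+ 2 * h * (alpha * G) ^+ 2); last by ring.
  by rewrite ler_wpM2l// mulr_ge0 ?sqr_ge0// ltW.
have := ler_wpM2l (mulr_ge0 (sqr_ge0 HFmax) (sqr_ge0 r)) hd; lra.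
Qed.

End Trajectory.

(** * The high-probability rate *)

Lemma first_time_lt {R : realType} {d : measure_display} {Omega : measurableType d}
    (W : nat -> set Omega) (K : nat) (w : Omega) :
  (first_time W w < (K%:R : R)%:E)%E <-> exists2 k, (k < K)%N & W k w.
Proof.
split=> [/ereal_inf_lt[_ [k Wk <-]]|[k kK Wk]].
  by rewrite lte_fin ltr_nat => kK; exists k.
apply: (@le_lt_trans _ _ (k%:R%:E)); last by rewrite lte_fin ltr_nat.
by apply: ereal_inf_lbound; exists k.
Qed.

(** As [k0] is random, the condition [k0 < K] is made part of the event, and the probability bound
    covers it jointly with the rate. *)
Theorem theorem3 (R : realType) (n p : nat)
  (f psi : 'cV[R]_n -> R) (calU : set 'M[R]_(n, p)) (L : 'M[R]_(n, p) -> R)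
  (hA : assumptionA f psi calU L)
  (d : measure_display) (Omega : measurableType d) (P : probability Omega R)
  (x0 : 'cV[R]_n) (U : nat -> Omega -> 'M[R]_(n, p))
  (eta : nat -> Omega -> R) (s : nat -> Omega -> 'cV[R]_p)
  (x : nat -> Omega -> 'cV[R]_n)
  (halg : scpg f psi calU L x0 U eta s x)
  (alpha delta : R) (halpha : 0 < alpha < 1) (hdelta : 0 < delta < 1)
  (hB : assumptionB P U (well_aligned (f \+ psi) alpha U x) delta)
  (hbounded : bounded_set (sublevel (f \+ psi) x0))
  (hconvex : @convex_function R 'cV[R]_n setT (f \+ psi))
  (heta_min : 0 < eta_inf eta)
  (HFmax : R)
  (hHFmax : forall k w,
     (HF f psi x0 (U k w) (Hf psi calU L (U k w) (eta k w)) <= HFmax%:E)%E)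
  (xstar : 'cV[R]_n) (hxstar : argmin (f \+ psi) xstar)
  (beta : R) (hbeta : 0 < beta < 1)
  (K : nat) (hK : 1 / ((1 - beta) * (1 - delta)) - 1 < K%:R) :
  let F := f \+ psi in
  let C := rateC alpha (eta_inf eta) HFmax in
  let k0 : Omega -> \bar R := first_time (well_aligned F alpha U x) in
  (P [set w | (k0 w < (K%:R)%:E)%E /\
        (F (x K w) - F xstar <=
           1 / C * (level_radius F x0 ^+ 2
                      / ((1 - beta) * (1 - delta) * (K.+1)%:R - 1)))%R]
   >= (1 - expR (- (beta ^+ 2 / 2) * (1 - delta) * (K.+1)%:R))%:E)%E.
Proof.
cbv zeta; set F := f \+ psi; set C := rateC _ _ _.
set b := 1 / C * _; set E := [set w | _].
have [a0 _] := andP halpha.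
pose W := well_aligned F alpha U x.
pose c := (1 - beta) * ((1 - delta) * K.+1%:R).
have c1 : 1 < c.
  have bd : 0 < (1 - beta) * (1 - delta) by rewrite mulr_gt0; lra.
  by move: hK; rewrite ltrBlDr natr1 ltr_pdivrMr// /c mulrA mulrC.
have pastW k : past U k.+1 (W k).
  by have := well_aligned_past halg (k := k) (ltW a0)
    (continuous_gradient_objective hA); exact.
have past_meas k := @past_sub_measurable _ _ _ _ _ U k (sample_random halg).
have mfew := measurable_nb_events_lt past_meas pastW 0 K.+1 c measurableT.
rewrite setTI in mfew; set few := [set w | _] in mfew.
(* [k0 < K] is a finite union of alignment events, and the rate compares a continuous function of
   [x K] with a constant. *)
have mE : measurable E.
  rewrite [E](_ : _ = (\bigcup_(k < K) W k) `&`
      [set w | F (x K w) - F xstar <= b]).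
    apply: measurableI.
      by apply: bigcup_measurable => k _; exact: past_meas (pastW k).
    have mF : measurable_fun setT (fun w => F (x K w)).
      apply: measurable_continuous_mx.
        move=> y; apply: differentiable_continuous.
        exact: differentiable_objective hA y.
      move=> i _ B mB; rewrite setTI; apply: (past_meas K).
      exact: (past_measurableP _ _ _).1 (iterate_past_measurable halg i) B mB.
    have /(_ measurableT [set true] Logic.I) := measurable_fun_ler
      (measurable_funB mF (measurable_cst (F xstar))) (measurable_cst b).
    by rewrite setTI; exact.
  apply/seteqP; split => w [].
    by move=> /first_time_lt[k kK Wk] ?; split=> //; exists k.
  by move=> [k kK Wk] ?; split=> //; apply/first_time_lt; exists k.
have sub : ~` few `<=` E.
  move=> w /= /negP; rewrite -leNgt => hc.
  (* The Chernoff bound counts iterations 0 to [K], but the gap at [x K] is governed by those before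
     [K]; discarding the last costs at most one, whence the [- 1] in the rate. *)
  have hN : c - 1 <= (nb_events W 0 K w)%:R.
    move: hc; rewrite /nb_events !add0n big_nat_recr//= natrD => hc.
    by have : (w \in W K)%:R <= 1 :> R; [case: (w \in W K)|lra].
  split.
    (* Without an aligned iteration before [K] the count would be 0, against [c - 1 > 0]. *)
    apply/first_time_lt; apply: contrapT => /forall2NP noW.
    move: hN; rewrite /nb_events big_nat big1; first lra.
    move=> j /andP[_]; rewrite add0n => jK; rewrite memNset// => Wj.
    by case: (noW j).
  rewrite /b -[(1 - beta) * _ * _]mulrA -/c mulrA ler_pdivlMr; last by lra.
  have := scpg_gap_mul_count hA halg heta_min a0 hbounded hconvex hHFmax hxstar w K.
  apply: le_trans; rewrite ler_wpM2l// subr_ge0; exact: hxstar.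
have : (P (~` few) <= P E)%E.
  by apply: le_measure; rewrite ?inE//; exact: measurableC.
apply: le_trans; rewrite probability_setC// EFinB leeB//.
apply: chernoff_nb_events => //.
- by move=> k; exact: past_le.
- by move=> k A B; exact: (@measurableI _ (g_sigma_algebraType (past_gen U k))).
- by move=> k A B; exact: (@measurableD _ (g_sigma_algebraType (past_gen U k))).
- exact: (@measurableT _ (g_sigma_algebraType (past_gen U 0))).
Qed.
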